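(* Let $q\in\mathbb{C}$ with $0<|q|<1$, and let $q^{1/2}$ be a fixed square root of $q$. For a complex number $x$ with $0<|x|<1$ and an integer $n\ge 0$ put $$a_n(x)=x^{3n^2+2n}\,\frac{1-x^{2n+1}}{1-x^2}\sum_{|j|\le n}(-1)^j x^{-j^2}.$$ For $n\ge 0$ define $$\dot\alpha_n=q^{-n^2-n}\bigl(a_n(q^{1/2})+a_n(-q^{1/2})\bigr),\qquad \dot\beta_n=\frac{2(-1)^n}{(q^2;q^2)_n\,(1-q^{2n+1})}.$$ Then $(\dot\alpha_n,\dot\beta_n)_{n\ge0}$ is a Bailey pair relative to $a=q$ (with base $q$); that is, for every integer $n\ge 0$, $$\dot\beta_n=\sum_{j=0}^{n}\frac{\dot\alpha_j}{(q;q)_{n-j}\,(q^2;q)_{n+j}}.$$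
   Context: Notation: $(x;q)_n=(1-x)(1-xq)\cdots(1-xq^{n-1})$ for $n\ge 0$, with $(x;q)_0=1$. A pair of sequences $(\alpha_n,\beta_n)_{n\ge0}$ is a Bailey pair relative to $a$ (with base $q$) if $\beta_n=\sum_{j=0}^{n}\frac{\alpha_j}{(q;q)_{n-j}(aq;q)_{n+j}}$ for all $n\ge 0$. The sum $\sum_{|j|\le n}$ runs over integers $j$ with $-n\le j\le n$. *)

(* Defs.v *)
From HB Require Import structures.
From mathcomp Require Import all_boot all_order all_algebra.

Set Implicit Arguments.
Unset Strict Implicit.
Unset Printing Implicit Defensive.

Import Order.TTheory GRing.Theory Num.Theory.
Local Open Scope ring_scope.

(* (x; q)_n *)
Definition qpoch (F : fieldType) (x q : F) (n : nat) : F :=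
  \prod_(0 <= i < n) (1 - x * q ^+ i).

Definition bailey_pair (F : fieldType) (q a : F) (alpha beta : nat -> F) : Prop :=
  forall n : nat,
    beta n = \sum_(0 <= j < n.+1)
               alpha j / (qpoch q q (n - j) * qpoch (a * q) q (n + j)).

(* Sum of f j over the integers j with -n <= j <= n, indexed by k = j + n. *)
Definition sum_absle (V : nmodType) (n : nat) (f : int -> V) : V :=
  \sum_(0 <= k < (2 * n).+1) f (k%:Z - n%:Z).

(* Exponents that may be negative are integer powers (exprz); those in
   x ^+ m are natural numbers. *)
Definition a_seq (F : fieldType) (x : F) (n : nat) : F :=
  x ^+ (3 * n ^ 2 + 2 * n) * ((1 - x ^+ (2 * n + 1)) / (1 - x ^+ 2))
  * sum_absle n (fun j : int => (-1) ^ j * x ^ (- j ^+ 2)).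

(* s is the chosen square root of q. *)
Definition alpha_dot (F : fieldType) (q s : F) (n : nat) : F :=
  q ^- (n ^ 2 + n) * (a_seq s n + a_seq (- s) n).

Definition beta_dot (F : fieldType) (q : F) (n : nat) : F :=
  2 * (-1) ^+ n / (qpoch (q ^+ 2) (q ^+ 2) n * (1 - q ^+ (2 * n + 1))).

(* Main.v *)
Require Import Defs.
From mathcomp Require Import all_boot all_order all_algebra.
From mathcomp Require Import reals complex.
From mathcomp Require Import ring zify.

Import Order.TTheory GRing.Theory Num.Theory.
Local Open Scope ring_scope.
Local Open Scope complex_scope.

(* Let H_n be the sum of q^(2ik) over i + k = n - 1, i, k >= 0. Separating even
   and odd j in a_n(s) + a_n(-s) gives
     alpha_n = 2 (-1)^n / (1 - q) * (H_(n+1) + q^(2n) H_n).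
   Multiplied by (q; q)_(2n+1) / 2, the Bailey sum becomes a sum against the
   q-binomials [2n+1, n+1+j]. Summation by parts, the two Pascal rules and
   H_(j+2) = 2 + q^(2j) H_j reduce it to the sum of (-1)^j [2n, n+j] over
   |j| <= n, which is (-1)^n (q; q^2)_n by a theorem of Gauss. *)

(** * q-shifted factorials *)

Lemma qpochS (F : fieldType) (x q : F) (n : nat) :
  qpoch x q n.+1 = qpoch x q n * (1 - x * q ^+ n).
Proof. by rewrite /qpoch big_nat_recr. Qed.

Lemma qpochSl (F : fieldType) (x q : F) (n : nat) :
  qpoch x q n.+1 = (1 - x) * qpoch (x * q) q n.
Proof.
rewrite /qpoch big_nat_recl // expr0 mulr1; congr (_ * _).
by apply: eq_bigr => i _; rewrite exprS mulrA.
Qed.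

Lemma qpoch_neq0 (F : fieldType) (q : F) (n : nat) :
  (forall k, q ^+ k.+1 != 1) -> qpoch q q n != 0.
Proof.
move=> q_neq1; elim: n => [|n IHn]; first by rewrite /qpoch big_geq ?oner_eq0.
by rewrite qpochS mulf_neq0 // -exprS subr_eq0 eq_sym.
Qed.

Lemma qpoch_double (F : fieldType) (q : F) (n : nat) :
  qpoch q q (2 * n) = qpoch q (q ^+ 2) n * qpoch (q ^+ 2) (q ^+ 2) n.
Proof.
elim: n => [|n IHn]; first by rewrite muln0 /qpoch !big_geq ?mulr1.
rewrite (_ : 2 * n.+1 = (2 * n).+2)%N; last by lia.
by rewrite !qpochS IHn -exprM (exprS _ (2 * n)); ring.
Qed.

(** * Gaussian binomial coefficients *)

(** The Gaussian binomial [n, k]. Defining it by a Pascal rule avoids division and makes it vanish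
    for k > n. *)
Fixpoint qbin (F : fieldType) (q : F) (n k : nat) : F :=
  match n, k with
  | _, 0%N => 1
  | 0%N, _.+1 => 0
  | n'.+1, k'.+1 => qbin F q n' k' + q ^+ k * qbin F q n' k
  end.
Arguments qbin {F} q n k : simpl never.

Lemma qbin0 (F : fieldType) (q : F) (n : nat) : qbin q n 0 = 1.
Proof. by case: n. Qed.

Lemma qbinS (F : fieldType) (q : F) (n k : nat) :
  qbin q n.+1 k.+1 = qbin q n k + q ^+ k.+1 * qbin q n k.+1.
Proof. by []. Qed.

Lemma qbin_small (F : fieldType) (q : F) (n k : nat) :
  (n < k)%N -> qbin q n k = 0.
Proof.
elim: n k => [|n IHn] [|k] // lt_nk.
by rewrite qbinS !IHn ?mulr0 ?addr0 // ltnW.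
Qed.

(** Double induction; the step rests on (1 - q^(k+1)) + q^(k+1) (1 - q^(m+1)) = 1 - q^(k+m+2). With
    denominators cleared, q may be arbitrary. *)
Lemma qbin_fact (F : fieldType) (q : F) (m k : nat) :
  qbin q (k + m) k * (qpoch q q k * qpoch q q m) = qpoch q q (k + m).
Proof.
have qpoch0 : qpoch q q 0 = 1 by rewrite /qpoch big_geq.
elim: k m => [|k IHk] m; first by rewrite qbin0 qpoch0 !mul1r.
elim: m => [|m IHm].
  have := IHk 0%N; rewrite !addn0 qpoch0 !mulr1 => IHk0.
  by rewrite qbinS [X in _ + _ * X]qbin_small // mulr0 addr0 qpochS mulrA IHk0.
have := IHk m.+1; rewrite addnS => IHkm.
rewrite addSn addnS qbinS mulrDl [qpoch q q (_).+2]qpochS.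
rewrite -addSn.
have -> : qbin q (k.+1 + m) k * (qpoch q q k.+1 * qpoch q q m.+1) =
   (1 - q * q ^+ k) * qpoch q q (k.+1 + m).
  by rewrite addSn -IHkm qpochS; ring.
have -> : q ^+ k.+1 * qbin q (k.+1 + m) k.+1 * (qpoch q q k.+1 * qpoch q q m.+1)
   = q ^+ k.+1 * (1 - q * q ^+ m) * qpoch q q (k.+1 + m).
  by rewrite -IHm (qpochS _ _ _ m); ring.
by rewrite exprS exprD exprS; ring.
Qed.

Lemma qbin_sym (F : fieldType) (q : F) (m k : nat) :
  (forall i, q ^+ i.+1 != 1) -> qbin q (k + m) k = qbin q (k + m) m.
Proof.
move=> q_neq1.
apply: (mulIf (mulf_neq0 (qpoch_neq0 _ q k q_neq1) (qpoch_neq0 _ q m q_neq1))).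
by rewrite qbin_fact [in RHS]mulrC [in RHS]addnC [in RHS]mulrC
           [qpoch q q k * _]mulrC qbin_fact addnC.
Qed.

Lemma qbin_next (F : fieldType) (q : F) (n k : nat) :
  (forall i, q ^+ i.+1 != 1) ->
  (1 - q ^+ k.+1) * qbin q n k.+1 = (1 - q ^+ (n - k)) * qbin q n k.
Proof.
move=> q_neq1; have [lt_kn|le_nk] := ltnP k n; last first.
  (* Truncated subtraction gives [n - k = 0], so the right side vanishes as well. *)
  rewrite qbin_small // mulr0; move: le_nk; rewrite -subn_eq0 => /eqP ->.
  by rewrite expr0 subrr mul0r.
have [m def_n] : exists m, n = (k + m.+1)%N by exists (n - k).-1; lia.
apply: (mulIf (mulf_neq0 (qpoch_neq0 _ q k q_neq1) (qpoch_neq0 _ q m q_neq1))).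
have := qbin_fact F q m k.+1; have := qbin_fact F q m.+1 k.
rewrite addSnnS -def_n !qpochS -!exprS => fact_k fact_k1.
rewrite (_ : n - k = m.+1)%N; last by lia.
by transitivity (qpoch q q n); [rewrite -fact_k1 | rewrite -fact_k]; ring.
Qed.

Lemma qbin_absorb (F : fieldType) (q : F) (n k : nat) :
  (forall i, q ^+ i.+1 != 1) ->
  (1 - q ^+ k.+1) * qbin q n.+1 k.+1 = (1 - q ^+ n.+1) * qbin q n k.
Proof.
move=> q_neq1; have [le_kn|lt_nk] := leqP k n; last first.
  by rewrite !qbin_small // !mulr0.
rewrite qbinS mulrDr mulrCA qbin_next //.
have -> : q ^+ n.+1 = q ^+ k.+1 * q ^+ (n - k) by rewrite -exprD addSn subnKC.
by ring.
Qed.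

Lemma qbinS_dual (F : fieldType) (q : F) (n k : nat) :
  (forall i, q ^+ i.+1 != 1) ->
  qbin q n.+1 k.+1 = q ^+ (n - k) * qbin q n k + qbin q n k.+1.
Proof.
move=> q_neq1; rewrite qbinS.
transitivity (q ^+ (n - k) * qbin q n k + (1 - q ^+ (n - k)) * qbin q n k
              + q ^+ k.+1 * qbin q n k.+1); first by ring.
by rewrite -qbin_next //; ring.
Qed.

(** * Gauss's alternating sum *)

(** Pascal and absorption give [n+2, k+1] = [n+1, k] + [n+1, k+1] - (1 - q^(n+1)) [n, k]. In the
    alternating sum the first two terms cancel up to a boundary 1, which the term k = 0 absorbs. *)
Lemma gauss_qbin_rec (F : fieldType) (q : F) (n : nat) :
  (forall i, q ^+ i.+1 != 1) ->
  \sum_(0 <= k < n.+3) (-1) ^+ k * qbin q n.+2 k =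
  (1 - q ^+ n.+1) * \sum_(0 <= k < n.+1) (-1) ^+ k * qbin q n k.
Proof.
move=> q_neq1; rewrite big_nat_recl // qbin0 expr0 mulr1.
have -> : \sum_(0 <= k < n.+2) (-1) ^+ k.+1 * qbin q n.+2 k.+1 =
  - \sum_(0 <= k < n.+2) (-1) ^+ k * qbin q n.+1 k
  + \sum_(0 <= k < n.+2) (-1) ^+ k.+1 * qbin q n.+1 k.+1
  + (1 - q ^+ n.+1) * \sum_(0 <= k < n.+2) (-1) ^+ k * qbin q n k.
  rewrite -sumrN mulr_sumr -!big_split /=; apply: eq_bigr => k _.
  by rewrite [in LHS]qbinS mulrCA -qbin_absorb // exprS; ring.
have -> : \sum_(0 <= k < n.+2) (-1) ^+ k.+1 * qbin q n.+1 k.+1 =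
    \sum_(0 <= k < n.+3) (-1) ^+ k * qbin q n.+1 k - 1.
  by rewrite [in RHS]big_nat_recl // qbin0 expr0 mulr1 addrAC subrr add0r.
rewrite [X in X - 1]big_nat_recr // [X in (1 - _) * X]big_nat_recr //=.
by rewrite !qbin_small //; ring.
Qed.

Lemma gauss_qbin (F : fieldType) (q : F) (n : nat) :
  (forall i, q ^+ i.+1 != 1) ->
  \sum_(0 <= k < (2 * n).+1) (-1) ^+ k * qbin q (2 * n) k = qpoch q (q ^+ 2) n.
Proof.
move=> q_neq1; elim: n => [|n IHn].
  by rewrite muln0 big_nat1 /qpoch big_geq ?mulr1.
rewrite (_ : 2 * n.+1 = (2 * n).+2)%N; last by lia.
by rewrite gauss_qbin_rec // IHn qpochS -exprM exprS mulrC.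
Qed.

Lemma alternating_sum_fold (F : fieldType) (n : nat) (c : nat -> F) :
  (forall j, (j <= n)%N -> c (n - j)%N = c (n + j)%N) ->
  \sum_(0 <= k < (2 * n).+1) (-1) ^+ k * c k =
  (-1) ^+ n * (c n + 2 * \sum_(1 <= j < n.+1) (-1) ^+ j * c (n + j)%N).
Proof.
move=> c_sym; rewrite (big_cat_nat _ (n := n)) //=; last by lia.
rewrite (big_ltn (m := n)); last by lia.
have sign_sub j : (j <= n)%N -> (-1) ^+ (n - j) = (-1) ^+ n * (-1) ^+ j :> F.
  move=> le_jn; rewrite -[in RHS](subnK le_jn) exprD -mulrA -exprD addnn.
  by rewrite -[in RHS](signr_odd _ j.*2) odd_double mulr1.
have -> : \sum_(0 <= k < n) (-1) ^+ k * c k =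
    \sum_(1 <= j < n.+1) (-1) ^+ n * ((-1) ^+ j * c (n + j)%N).
  rewrite big_nat_rev /= add0n [RHS]big_add1 /=.
  by apply: eq_big_nat => k /andP[_ lt_kn]; rewrite sign_sub // c_sym // mulrA.
have -> : \sum_(n.+1 <= k < (2 * n).+1) (-1) ^+ k * c k =
    \sum_(1 <= j < n.+1) (-1) ^+ n * ((-1) ^+ j * c (n + j)%N).
  rewrite -[n.+1 in LHS]add1n big_addn (_ : (2 * n).+1 - n = n.+1)%N; last by lia.
  apply: eq_bigr => j _.
  by rewrite exprD addnC mulrA; ring.
by rewrite -!mulr_sumr; ring.
Qed.

(** * The sums H_n and summation by parts *)

Definition hecke_sum (F : fieldType) (q : F) (n : nat) : F :=
  \sum_(0 <= i < n) q ^+ (2 * (i * (n.-1 - i))).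
Arguments hecke_sum {F} q n.

Lemma hecke_sum0 (F : fieldType) (q : F) : hecke_sum q 0 = 0.
Proof. by rewrite /hecke_sum big_geq. Qed.

Lemma hecke_sum1 (F : fieldType) (q : F) : hecke_sum q 1 = 1.
Proof. by rewrite /hecke_sum big_nat1. Qed.

(** The two end terms are 1 each; inside, (i+1)(k+1) = ik + n when i + k = n - 1. *)
Lemma hecke_sumSS (F : fieldType) (q : F) (n : nat) :
  hecke_sum q n.+2 = 2 + q ^+ (2 * n) * hecke_sum q n.
Proof.
rewrite /hecke_sum big_nat_recl // big_nat_recr //= mul0n subnn muln0 muln0 expr0.
rewrite addrCA addrA -addrA -[1 + 1]/2 addrC mulr_sumr; congr (_ + _).
apply: eq_big_nat => i /andP[_ lt_in]; rewrite -exprD; congr (_ ^+ _).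
by have [m ->] : exists m, n = (i + m.+1)%N by [exists (n - i).-1; lia]; nia.
Qed.

Lemma hecke_sum_by_parts (F : fieldType) (q : F) (c : nat -> F) (n : nat) :
  (forall j, (n < j)%N -> c j = 0) ->
  \sum_(0 <= j < n.+1)
    (-1) ^+ j * hecke_sum q j.+1 * (c j - q ^+ (2 * j + 2) * c j.+2) =
  c 0%N + 2 * \sum_(1 <= j < n.+1) (-1) ^+ j * c j.
Proof.
move=> c_small.
(* Freeing the upper bound allows induction through the recurrence of H. The last summand is the
   boundary term, which vanishes at [m = n] because [c] is zero beyond [n]. *)
have partial m : \sum_(0 <= j < m.+1)
    (-1) ^+ j * hecke_sum q j.+1 * (c j - q ^+ (2 * j + 2) * c j.+2) =
  c 0%N + 2 * \sum_(1 <= j < m.+1) (-1) ^+ j * c j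
  + (-1) ^+ m * (hecke_sum q m * q ^+ (2 * m) * c m.+1
    - hecke_sum q m.+1 * q ^+ (2 * m + 2) * c m.+2).
  elim: m => [|m IHm].
    by rewrite big_nat1 big_geq // hecke_sum0 hecke_sum1 muln0 add0n; ring.
  rewrite big_nat_recr //= IHm [in RHS]big_nat_recr //= hecke_sumSS.
  rewrite (_ : 2 * m.+1 = 2 * m + 2)%N; last by lia.
  by rewrite exprS; ring.
by rewrite partial (c_small n.+1) ?(c_small n.+2) ?ltnS ?leqnSn //; ring.
Qed.

(* Both Pascal rules, applied to the two q-binomials on the left, produce the
   same multiple of [2n, n + j + 1], which cancels. *)
Lemma qbin_odd_even (F : fieldType) (q : F) (n j : nat) :
  (forall i, q ^+ i.+1 != 1) ->
  qbin q (2 * n).+1 (n + j).+1 - q ^+ (2 * j + 2) * qbin q (2 * n).+1 (n + j).+2 =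
  qbin q (2 * n) (n + j) - q ^+ (2 * j + 2) * qbin q (2 * n) (n + j).+2.
Proof.
move=> q_neq1; rewrite qbinS qbinS_dual // mulrDr opprD mulrA -exprD addrA.
(* For [j >= n] the common coefficient [2n, n+j+1] is zero, so the truncated exponent is
   harmless. *)
have [lt_jn|le_nj] := ltnP j n; last first.
  by rewrite (qbin_small _ _ _ (n + j).+1) ?mulr0 ?subr0 ?addr0 //; lia.
rewrite (_ : 2 * j + 2 + (2 * n - (n + j).+1) = (n + j).+1)%N; last by lia.
by rewrite addrK.
Qed.

Lemma hecke_qbin_sum (F : fieldType) (q : F) (n : nat) :
  (forall i, q ^+ i.+1 != 1) ->
  \sum_(0 <= j < n.+1) (-1) ^+ j *
     (hecke_sum q j.+1 + q ^+ (2 * j) * hecke_sum q j)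
     * qbin q (2 * n).+1 (n + j).+1 = (-1) ^+ n * qpoch q (q ^+ 2) n.
Proof.
move=> q_neq1; rewrite -gauss_qbin //.
rewrite (@alternating_sum_fold F n (qbin q (2 * n))); last first.
  move=> j le_jn; rewrite (_ : 2 * n = (n - j) + (n + j))%N; last by lia.
  by rewrite qbin_sym.
rewrite mulrA -exprD addnn -signr_odd odd_double mul1r.
have := @hecke_sum_by_parts F q (fun j => qbin q (2 * n) (n + j)) n.
rewrite addn0 => <-; last by move=> j lt_nj; rewrite qbin_small //; lia.
under [RHS]eq_bigr => j _ do rewrite !(addnS n) -qbin_odd_even // mulrBr.
rewrite sumrB; under [LHS]eq_bigr => j _ do rewrite (mulrDr (_ ^+ j)) mulrDl.
rewrite big_split /=; congr (_ + _).
(* The two sums agree after a shift of [j]: the first term on the left has H_0 = 0, the last on the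
   right has [2n+1, 2n+2] = 0. *)
rewrite big_nat_recl // [in RHS]big_nat_recr //=.
rewrite hecke_sum0 !mulr0 mul0r add0r.
rewrite (qbin_small _ _ _ (n + n).+2) ?mulr0; last by lia.
rewrite addr0 -sumrN; apply: eq_bigr => j _.
by rewrite exprS addnS (_ : 2 * j.+1 = 2 * j + 2)%N; [ring | lia].
Qed.

(** * Theta sums and the closed form of alpha_n *)

Lemma sum_even_odd (V : nmodType) (g : nat -> V) (n : nat) :
  \sum_(0 <= k < (2 * n).+1) g k =
  \sum_(0 <= i < n.+1) g (2 * i)%N + \sum_(0 <= i < n) g (2 * i).+1.
Proof.
elim: n => [|n IHn]; first by rewrite muln0 !big_nat1 big_geq ?addr0.
rewrite (_ : 2 * n.+1 = (2 * n).+2)%N; last by lia.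
rewrite big_nat_recr // big_nat_recr //= IHn [in RHS]big_nat_recr //=.
rewrite [X in _ = _ + X]big_nat_recr //= (_ : 2 * n.+1 = (2 * n).+2)%N; last by lia.
by rewrite -!addrA; congr (_ + _); rewrite addrA addrC.
Qed.

(* The factor x^(n^2) turns the Laurent polynomial in the definition of a_n
   into a polynomial, since n^2 - (k - n)^2 = k (2 n - k). *)
Lemma sum_absle_theta (F : fieldType) (x : F) (n : nat) : x != 0 ->
  x ^+ (n ^ 2) * sum_absle n (fun j : int => (-1) ^ j * x ^ (- j ^+ 2)) =
  (-1) ^+ n * \sum_(0 <= k < (2 * n).+1) (-1) ^+ k * x ^+ (k * (2 * n - k)).
Proof.
move=> x_neq0; rewrite /sum_absle !mulr_sumr.
apply: eq_big_nat => k /andP[_ le_k2n].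
rewrite mulrCA [RHS]mulrA; congr (_ * _).
  have sgn_neq0 : (-1 : F) != 0 by rewrite oppr_eq0 oner_eq0.
  rewrite expfzDr // mulrC -invr_expz; congr (_ * _).
  by rewrite -exprnP -exprVn invrN1.
rewrite -[x ^+ (n ^ 2)]/(x ^ (n ^ 2)%N%:Z) -[RHS]/(x ^ (k * (2 * n - k))%N%:Z).
rewrite -expfzDr //; congr (x ^ _).
have [m def_m] : exists m, (2 * n = k + m)%N by exists (2 * n - k)%N; lia.
by rewrite def_m addKn expr2; nia.
Qed.

(** Of the exponent 3n^2 + 2n, the part n^2 clears the negative powers in the theta sum; the rest,
    2(n^2 + n), cancels q^(-n^2-n) when q = x^2. *)
Lemma a_seq_theta (F : fieldType) (x : F) (n : nat) : x != 0 ->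
  x ^- (2 * (n ^ 2 + n)) * a_seq x n =
  (1 - x ^+ (2 * n + 1)) / (1 - x ^+ 2) * (-1) ^+ n *
  \sum_(0 <= k < (2 * n).+1) (-1) ^+ k * x ^+ (k * (2 * n - k)).
Proof.
move=> x_neq0; rewrite -mulrA -sum_absle_theta // /a_seq.
rewrite (_ : 3 * n ^ 2 + 2 * n = 2 * (n ^ 2 + n) + n ^ 2)%N; last by lia.
rewrite exprD -!mulrA mulKf ?expf_neq0 //.
by rewrite [LHS]mulrCA; congr (_ * _); rewrite mulrCA.
Qed.

(** With E and O the parts of the theta sum over even and odd k, the two terms combine as (1 -
    s^(2n+1))(E - O) + (1 + s^(2n+1))(E + O) = 2(E + s^(2n+1) O). *)
Lemma alpha_dot_hecke (F : fieldType) (q s : F) (n : nat) :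
  s != 0 -> s ^+ 2 = q ->
  alpha_dot q s n = 2 / (1 - q) *
    ((-1) ^+ n * (hecke_sum q n.+1 + q ^+ (2 * n) * hecke_sum q n)).
Proof.
move=> s_neq0 def_q; rewrite /alpha_dot mulrDr -def_q -exprM a_seq_theta //.
have -> : s ^- (2 * (n ^ 2 + n)) = (- s) ^- (2 * (n ^ 2 + n)).
  by rewrite !exprM sqrrN.
rewrite a_seq_theta ?oppr_eq0 // sqrrN.
have -> : (- s) ^+ (2 * n + 1) = - s ^+ (2 * n + 1).
  by rewrite addn1 !exprS !(exprM _ 2) sqrrN mulNr.
have -> : \sum_(0 <= k < (2 * n).+1) (-1) ^+ k * (- s) ^+ (k * (2 * n - k)) =
          \sum_(0 <= k < (2 * n).+1) s ^+ (k * (2 * n - k)).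
  (* The signs cancel because k(2n - k) has the parity of k. *)
  apply: eq_big_nat => k /andP[_ le_k2n]; rewrite (exprNn s) mulrA -exprD.
  rewrite -signr_odd (_ : odd _ = false) ?mul1r //.
  by rewrite oddD oddM oddB // oddM; case: (odd k).
rewrite !sum_even_odd; set odds := \sum_(0 <= i < n) s ^+ ((2 * i).+1 * _).
set evens := \sum_(0 <= i < n.+1) s ^+ (2 * i * _).
have -> : \sum_(0 <= i < n.+1) (-1) ^+ (2 * i) * s ^+ (2 * i * (2 * n - 2 * i))
          = evens.
  by apply: eq_bigr => i _; rewrite exprM sqrrN expr1n expr1n mul1r.
have -> : \sum_(0 <= i < n) (-1) ^+ (2 * i).+1
            * s ^+ ((2 * i).+1 * (2 * n - (2 * i).+1)) = - odds.
  rewrite -sumrN; apply: eq_bigr => i _.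
  by rewrite exprS exprM sqrrN expr1n expr1n mulr1 mulN1r.
have <- : evens = hecke_sum (s ^+ 2) n.+1.
  apply: eq_bigr => i _; rewrite -exprM /= -mulnBr; congr (_ ^+ _).
  by nia.
have <- : s ^+ (2 * n + 1) * odds = (s ^+ 2) ^+ (2 * n) * hecke_sum (s ^+ 2) n.
  (* With i + k = n - 1, (2i+1)(2k+1) + 2n + 1 = 4(ik + n). *)
  rewrite !mulr_sumr; apply: eq_big_nat => i /andP[_ lt_in].
  rewrite -!exprM -!exprD; congr (_ ^+ _).
  by have [m ->] : exists m, n = (i + m.+1)%N by [exists (n - i).-1; lia]; nia.
by rewrite opprK; ring.
Qed.

(** * The Bailey pair *)

Lemma alpha_beta_bailey (F : fieldType) (q s : F) :
  s != 0 -> s ^+ 2 = q -> (forall i, q ^+ i.+1 != 1) ->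
  bailey_pair q q (alpha_dot q s) (beta_dot q).
Proof.
move=> s_neq0 def_q q_neq1 n.
have q1_neq0 : 1 - q != 0 by rewrite subr_eq0 eq_sym (q_neq1 0%N).
have qpoch_n0 m := qpoch_neq0 F q m q_neq1.
(* Since (q; q)_(n+j+1) = (1 - q) (q^2; q)_(n+j), the factor 1/(1 - q) of alpha_j completes the
   denominator of [2n+1, n+j+1]. *)
transitivity (\sum_(0 <= j < n.+1) 2 / qpoch q q (2 * n).+1 *
    ((-1) ^+ j * (hecke_sum q j.+1 + q ^+ (2 * j) * hecke_sum q j)
     * qbin q (2 * n).+1 (n + j).+1)); last first.
  apply: eq_big_nat => j /andP[_ le_jn]; rewrite (alpha_dot_hecke F q s) //.
  have := qbin_fact F q (n - j) (n + j).+1.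
  rewrite (_ : (n + j).+1 + (n - j) = (2 * n).+1)%N; last by lia.
  have := qpoch_n0 (2 * n).+1 => /[swap] <-; rewrite qpochSl.
  have := qpoch_n0 (n + j).+1; rewrite qpochSl.
  rewrite !mulf_eq0 !negb_or => /andP[_ A0] /andP[B0 /andP[_ C0]].
  by field; rewrite A0 B0 C0 q1_neq0.
(* The factor (q; q^2)_n cancels in (q; q)_(2n+1) = (q; q^2)_n (q^2; q^2)_n (1 - q^(2n+1)), leaving
   beta_n. *)
rewrite -mulr_sumr hecke_qbin_sum // qpochS qpoch_double /beta_dot.
have := qpoch_n0 (2 * n).+1; rewrite qpochS qpoch_double.
rewrite addn1 [q ^+ (2 * n).+1]exprS.
rewrite !mulf_eq0 !negb_or => /andP[/andP[A0 B0] C0].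
by field; rewrite A0 B0 C0.
Qed.

Theorem theorem2p1 (R : realType) (q s : R[i])
    (q_gt0 : 0 < `|q|) (q_lt1 : `|q| < 1) (sqrt_q : s ^+ 2 = q) :
  bailey_pair q q (alpha_dot q s) (beta_dot q).
Proof.
apply: alpha_beta_bailey => // [|i].
  by move: q_gt0; rewrite normr_gt0 -sqrt_q expf_eq0.
apply/eqP => /(congr1 Num.norm) /eqP.
by rewrite normrX normr1 lt_eqF // exprn_ilt1.
Qed.
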